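(* Let $P$ be an empty $4$-simplex of volume $V$ and facet volumes $(V_0,V_1,V_2,V_3,V_4)$. Let $S=V_0+\dots+V_4$ be the surface area of $P$. Then the $h^*$-vector of $P$ is $$h^*_0=1,\quad h^*_1=0,\quad h^*_2=\frac{V+S}{2}-3,\quad h^*_3=\frac{V-S}{2}+2,\quad h^*_4=0.$$
   Context: Let $\Lambda$ be a lattice of rank $d$ in $\mathbb{R}^d$. An empty simplex is a lattice simplex (vertices in $\Lambda$) whose only lattice points are its vertices. Volumes are normalized so that a unimodular simplex has volume $1$; the volume of a facet is normalized with respect to the lattice of points of $\Lambda$ in its affine span. For a lattice $d$-polytope $P$ with Ehrhart polynomial $E(P,t)$ (so $E(P,t)=|tP\cap\Lambda|$ for $t\in\mathbb{N}$), the $h^*$-vector $(h^*_0,\dots,h^*_d)$ is defined by $$\sum_{n=0}^\infty E(P,n)x^n=\frac{h^*_dx^d+\dots+h^*_0}{(1-x)^{d+1}}.$$ *)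

(* Defs.v *)
From HB Require Import structures.
From mathcomp Require Import all_boot all_order all_algebra.
From mathcomp Require Import finmap.
From mathcomp Require Import boolp classical_sets functions cardinality reals.

Set Implicit Arguments.
Unset Strict Implicit.
Unset Printing Implicit Defensive.

Import Order.TTheory GRing.Theory Num.Theory.
Local Open Scope classical_set_scope.
Local Open Scope ring_scope.

(* Points of R^d are row vectors; a family of points is the matrix of its rows. *)

Section Lattices.
Variables (R : realType) (d : nat).

Definition int_span k (b : 'M[R]_(k, d)) : set 'rV[R]_d :=
  [set x | exists z : 'rV[int]_k, x = map_mx intr z *m b].

Definition lattice_basis k (L : set 'rV[R]_d) (b : 'M[R]_(k, d)) : Prop :=
  row_free b /\ L = int_span b.

(* The rank of the lattice is the dimension d of the ambient space. *)
Definition full_lattice (L : set 'rV[R]_d) : Prop :=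
  exists b : 'M[R]_(d, d), lattice_basis L b.

Definition affine_span k (v : 'M[R]_(k, d)) : set 'rV[R]_d :=
  [set x | exists2 a : 'rV[R]_k, \sum_i a 0 i = 1 & x = a *m v].

Definition conv_hull k (v : 'M[R]_(k, d)) : set 'rV[R]_d :=
  [set x | exists2 a : 'rV[R]_k,
     (forall i, 0 <= a 0 i) /\ \sum_i a 0 i = 1 & x = a *m v].

Definition edges k (v : 'M[R]_(k.+1, d)) : 'M[R]_(k, d) :=
  \matrix_(i < k) (row (lift ord0 i) v - row ord0 v).

Definition affinely_independent k (v : 'M[R]_(k.+1, d)) : Prop :=
  row_free (edges v).

(* Facet opposite to vertex i. *)
Definition facet k (v : 'M[R]_(k.+2, d)) (i : 'I_k.+2) : 'M[R]_(k.+1, d) :=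
  row' i v.

Definition empty_simplex k (L : set 'rV[R]_d) (v : 'M[R]_(k.+1, d)) : Prop :=
  [/\ affinely_independent v,
      forall i, L (row i v) &
      forall x, conv_hull v x -> L x -> exists i, x = row i v].

(* The lattice points of the affine span of v, translated so that the vertex
   number 0 becomes the origin. *)
Definition affine_lattice k (L : set 'rV[R]_d) (v : 'M[R]_(k.+1, d)) :
    set 'rV[R]_d :=
  [set x - row ord0 v | x in L `&` affine_span v].

(* Volume of the k-simplex v, normalized with respect to the lattice of points
   of L in its affine span: if M is the matrix of coordinates of the edges in a
   basis of that lattice, the linear map M sends a unimodular simplex (volume 1)
   to v, so the volume is |det M|.  The value does not depend on the basis; the
   default 0 is only taken if the affine lattice has no basis of k vectors, which
   does not happen for a simplex with vertices in a lattice L. *)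
Definition normalized_volume k (L : set 'rV[R]_d) (v : 'M[R]_(k.+1, d)) : R :=
  xget 0 [set w | exists b : 'M[R]_(k, d), exists M : 'M[R]_k,
    [/\ lattice_basis (affine_lattice L v) b,
        edges v = M *m b & w = `|\det M|]].

Definition dilate (t : R) (P : set 'rV[R]_d) : set 'rV[R]_d :=
  [set t *: x | x in P].

(* [fset_set] is the empty set on infinite sets; the set here is finite as
   soon as P is bounded and L is a lattice. *)
Definition ehrhart (L P : set 'rV[R]_d) (n : nat) : nat :=
  #|` fset_set (dilate n%:R P `&` L)|.

(* h is the h*-vector of the d-dimensional polytope P: as formal power series,
   (sum_n E(P, n) x^n) (1 - x)^(d+1) = h_d x^d + ... + h_0;
   the left-hand side of the equation below is the coefficient of x^n in the
   Cauchy product.  There is at most one such h. *)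
Definition is_hstar_vector (L P : set 'rV[R]_d) (h : 'rV[R]_d.+1) : Prop :=
  forall n : nat,
    \sum_(i < n.+1) (ehrhart L P i)%:R * ((1 - 'X : {poly R}) ^+ d.+1)`_(n - i)
    = (rVpoly h)`_n.

End Lattices.

(* Main.v *)
Require Import Defs.
From mathcomp Require Import all_boot all_order all_algebra finmap.
From mathcomp Require Import boolp classical_sets cardinality reals.
From mathcomp Require Import lra.

Set Implicit Arguments.
Unset Strict Implicit.
Unset Printing Implicit Defensive.

Import Order.TTheory GRing.Theory Num.Theory.
Local Open Scope classical_set_scope.
Local Open Scope ring_scope.

(** A lattice [k]-simplex [v] with vertices [v_0, ..., v_k] is studied through
    its half-open box
      [box L v = {a in [0, 1)^(k+1) | sum_i a_i is an integer, sum_i a_i v_i in L}],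
    a set of representatives of the finite group [Gamma / Z^(k+1)], where [Gamma]
    is the set of all coordinate rows [a] with [sum_i a_i] an integer and
    [a *m v] in [L].

    - Its cardinality is the normalized volume of [v] ([card_box]).  Dropping one
      coordinate turns the box into the lattice points of the parallelepiped
      spanned by the edges; the Smith normal form of the matrix of the edges
      reduces the count to a diagonal matrix, and also provides a basis of the
      lattice of the affine span.
    - The entry [h*_j] is the number of points of the box whose coordinates sum
      to [j], the points of height [j] ([ehrhart_series]).  A lattice point of
      the dilate [nP] has nonnegative coordinates with sum [n], and splits into
      its fractional part, a point of the box of some height [j], and its floor,
      a row of natural numbers with sum [n - j]; there are ['C(k + n - j, k)]
      of those, the coefficients of [x^j / (1 - x)^(k+1)].
    - The points of the box with [a_i = 0] are those of the box of the facet
      opposite to vertex [i] ([facet_volume]).  The involution [a |-> frac(- a)]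
      of the box satisfies [a_i + frac(- a_i) = 1] unless [a_i = 0], and hence
      twice the sum of all heights is [(k + 1) V - S] ([sum_heights]).

    For an empty simplex, 0 is the only point of height 0, and there is none of
    height 1, as it would be a lattice point of the simplex.  Nor is there any of
    height [k]: the complement [1 - a] would be such a point as well.  For
    [k = 4] all heights are below 5, so only 2 and 3 remain besides 0.  Hence
    [1 + h*_2 + h*_3 = V] and [2 (2 h*_2 + 3 h*_3) = 5 V - S], and these two linear
    equations determine [h*_2] and [h*_3]. *)

(** * Integer matrices and fractional parts *)

Section FractionalParts.
Variable R : realType.

Definition fract (x : R) : R := x - (Num.floor x)%:~R.

Lemma fract_itv x : 0 <= fract x < 1.
Proof.
rewrite subr_ge0 floor_le /= ltrBlDl.
by have := floorD1_gt x; rewrite intrD.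
Qed.

Lemma int_subr_fract x : x - fract x \is a Num.int.
Proof. by rewrite opprB addrC subrK intr_int. Qed.

Lemma eq_of_int_sub (x y : R) :
  0 <= x < 1 -> 0 <= y < 1 -> x - y \is a Num.int -> x = y.
Proof.
move=> /andP[x0 x1] /andP[y0 y1] xy; apply/eqP; rewrite -subr_eq0.
have : `|x - y| < 1 by rewrite ltr_norml; apply/andP; split; lra.
by apply: contraTT => /(norm_intr_ge1 xy); rewrite leNgt.
Qed.

Definition cube k : set 'rV[R]_k := [set a | forall i, 0 <= a 0 i < 1].

Definition fract_row k (a : 'rV[R]_k) : 'rV[R]_k := map_mx fract a.

Lemma cube_fract_row k (a : 'rV[R]_k) : cube (fract_row a).
Proof. by move=> i; rewrite mxE fract_itv. Qed.

Lemma int_mxD m n (A B : 'M[R]_(m, n)) : A \is a mxOver Num.int ->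
  B \is a mxOver Num.int -> A + B \is a mxOver Num.int.
Proof.
by move=> /mxOverP AZ /mxOverP BZ; apply/mxOverP => i j; rewrite mxE rpredD.
Qed.

Lemma int_mxB m n (A B : 'M[R]_(m, n)) : A \is a mxOver Num.int ->
  B \is a mxOver Num.int -> A - B \is a mxOver Num.int.
Proof.
by move=> /mxOverP AZ /mxOverP BZ; apply/mxOverP => i j; rewrite !mxE rpredB.
Qed.

Lemma int_mx_subC m n (A B : 'M[R]_(m, n)) :
  A - B \is a mxOver Num.int -> B - A \is a mxOver Num.int.
Proof.
move=> /mxOverP AB; apply/mxOverP => i j; have := AB i j.
by rewrite !mxE -opprB rpredN.
Qed.

Lemma int_mxM m n p (A : 'M[R]_(m, n)) (B : 'M[R]_(n, p)) :
  A \is a mxOver Num.int -> B \is a mxOver Num.int -> A *m B \is a mxOver Num.int.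
Proof.
move=> /mxOverP AZ /mxOverP BZ; apply/mxOverP => i j.
by rewrite mxE rpred_sum// => l _; rewrite rpredM.
Qed.

Lemma int_sub_fract_row k (a : 'rV[R]_k) : a - fract_row a \is a mxOver Num.int.
Proof. by apply/mxOverP => i j; rewrite !mxE int_subr_fract. Qed.

Lemma eq_cube_of_int_sub k (a b : 'rV[R]_k) :
  cube a -> cube b -> a - b \is a mxOver Num.int -> a = b.
Proof.
move=> ca cb /mxOverP ab; apply/rowP => i.
by apply: eq_of_int_sub (ca i) (cb i) _; have := ab 0 i; rewrite !mxE.
Qed.

Lemma int_map_intr m n (A : 'M[int]_(m, n)) :
  map_mx intr A \is a mxOver (Num.int : qualifier 1 R).
Proof. by apply/mxOverP => i j; rewrite mxE intr_int. Qed.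

Lemma int_mxP m n (A : 'M[R]_(m, n)) :
  A \is a mxOver Num.int -> exists N : 'M[int]_(m, n), A = map_mx intr N.
Proof.
move=> /mxOverP AZ; exists (map_mx Num.floor A).
by apply/matrixP => i j; rewrite !mxE floorK.
Qed.

Lemma int_spanP k d (b : 'M[R]_(k, d)) x :
  int_span b x <-> exists2 c : 'rV[R]_k, c \is a mxOver Num.int & x = c *m b.
Proof.
split=> [[z ->]|[c /int_mxP[z ->] ->]]; last by exists z.
by exists (map_mx intr z) => //; apply: int_map_intr.
Qed.

End FractionalParts.

(** * Lattice points of a half-open parallelepiped *)

Section Unimodular.
Variable R : realType.

Definition periodic k (A : set 'rV[R]_k) :=
  forall a b, a - b \is a mxOver Num.int -> A b -> A a.

(** A periodic set is a union of cosets of [Z^k], and the cube contains exactly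
    one point of each coset: a unimodular substitution permutes the cosets, and
    [a |-> frac(a U)] realizes it on the representatives. *)
Lemma card_cube_unimodular k (U : 'M[int]_k) (A B : set 'rV[R]_k) :
    U \in unitmx -> periodic B ->
    (forall a, A a <-> B (a *m map_mx intr U)) ->
  (@cube R k `&` A #= @cube R k `&` B)%card.
Proof.
move=> Uu perB AB; pose Ur : 'M[R]_k := map_mx intr U.
pose Vr : 'M[R]_k := map_mx intr (invmx U).
have UV : Ur *m Vr = 1%:M by rewrite -map_mxM mulmxV// map_mx1.
have VU : Vr *m Ur = 1%:M by rewrite -map_mxM mulVmx// map_mx1.
have UZ : Ur \is a mxOver Num.int by apply: int_map_intr.
have VZ : Vr \is a mxOver Num.int by apply: int_map_intr.
pose f (a : 'rV[R]_k) := fract_row (a *m Ur).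
have -> : cube (k := k) `&` B = f @` (@cube R k `&` A).
  apply/seteqP; split=> [b [cb Bb]|_ [a [ca Aa] <-]].
    have eb : fract_row (fract_row (b *m Vr) *m Ur) = b.
      apply: eq_cube_of_int_sub => //; first exact: cube_fract_row.
      set w := fract_row (b *m Vr); apply: int_mx_subC.
      rewrite -(subrK (w *m Ur) b) -addrA int_mxD ?int_sub_fract_row//.
      rewrite -[X in X - _]mulmx1 -VU mulmxA -mulmxBl.
      by rewrite int_mxM// int_sub_fract_row.
    exists (fract_row (b *m Vr)) => //; split; first exact: cube_fract_row.
    apply/AB; apply: perB Bb; rewrite -[X in _ - X]eb.
    exact: int_sub_fract_row.
  split; first exact: cube_fract_row.
  by move/AB: Aa; apply: perB; apply: int_mx_subC; apply: int_sub_fract_row.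
rewrite card_eq_sym; apply: inj_card_eq => a b.
rewrite !inE => -[ca _] [cb _] fab.
apply: eq_cube_of_int_sub => //.
rewrite -[a - b]mulmx1 -UV mulmxA mulmxBl int_mxM//.
rewrite -(subrK (f a) (a *m Ur)) -addrA int_mxD ?int_sub_fract_row//.
by rewrite fab int_mx_subC// int_sub_fract_row.
Qed.

End Unimodular.

Lemma card_finType (T : finType) : ([set: T] #= `I_#|T|)%card.
Proof.
have -> : `I_#|T| = (fun x : T => enum_rank x : nat) @` [set: T].
  apply/seteqP; split=> [i /= ilt|_ [x _ <-] /=]; last exact: ltn_ord.
  by exists (enum_val (Ordinal ilt)) => //; rewrite enum_valK.
rewrite card_eq_sym; apply: inj_card_eq => x y _ _ /ord_inj.
exact: enum_rank_inj.
Qed.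

Section LatticePointsOfACube.
Variable R : realType.

(** The points are the rows [t_i / d_i] with [0 <= t_i < d_i]. *)
Lemma card_cube_diag k (d : 'I_k -> nat) : (forall i, 0 < d i)%N ->
  (@cube R k `&` [set a | forall i, a 0 i * (d i)%:R \is a Num.int]
     #= `I_(\prod_i d i))%card.
Proof.
move=> d0; have dR0 i : 0 < (d i)%:R :> R by rewrite ltr0n.
have dRN0 i : (d i)%:R != 0 :> R by rewrite gt_eqF.
set A := _ `&` _.
pose T := {dffun forall i : 'I_k, 'I_(d i)}.
have -> : (\prod_i d i = #|T|)%N.
  rewrite card_dep_ffun foldrE big_map -big_enum /=.
  by apply: eq_bigr => i _; rewrite card_ord.
apply: card_eq_trans (card_finType T).
pose g (t : T) : 'rV[R]_k := \row_i ((t i)%:R / (d i)%:R).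
have -> : A = g @` [set: T].
  apply/seteqP; split=> [a [ca aZ]|_ [t _ <-]]; last first.
    split=> [i|i] /=; rewrite mxE; last by rewrite divfK// natr_int.
    by rewrite divr_ge0//= ltr_pdivrMr// mul1r ltr_nat.
  have tlt i : (Num.truncn (a 0 i * (d i)%:R)%R < d i)%N.
    have /andP[a0 a1] := ca i.
    by rewrite truncn_lt_nat ?mulr_ge0// gtr_pMl.
  exists [ffun i => Ordinal (tlt i)] => //.
  apply/rowP => i; rewrite mxE ffunE /= truncnK ?mulfK//.
  have /andP[a0 a1] := ca i.
  by rewrite natrEint aZ mulr_ge0.
apply: inj_card_eq => s t _ _ /rowP st; apply/ffunP => i; apply: val_inj.
have := st i; rewrite !mxE => /(mulIf (invr_neq0 (dRN0 i)))/eqP.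
by rewrite eqr_nat => /eqP.
Qed.

Lemma int_mul_abs (x : R) (z : int) :
  (x * z%:~R \is a Num.int) = (x * (absz z)%:R \is a Num.int).
Proof. by rewrite {1}[z]intEsign rmorphMsign mulrCA rpredMsign. Qed.

Lemma smith_square k (M : 'M[int]_k) : exists U D W,
  [/\ U \in unitmx, W \in unitmx & M = U *m diag_mx D *m W].
Proof.
have [U Uu [W Wu [s _ eM]]] := int_Smith_normal_form M.
exists U, (\row_i s`_i), W; split=> //; rewrite {1}eM.
by congr (_ *m _ *m _); apply/matrixP => i j; rewrite !mxE.
Qed.

(** This is the index [|det M|] of the sublattice [Z^k M] of [Z^k]: by Smith normal
    form and unimodular substitutions, [M] may be taken diagonal. *)
Lemma card_cube_int_preimage k (M : 'M[int]_k) : \det M != 0 ->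
  (@cube R k `&` [set a | a *m map_mx intr M \is a mxOver Num.int]
     #= `I_(absz (\det M)))%card.
Proof.
have [U [D [W [Uu Wu eM]]]] := smith_square M.
have absU (X : 'M[int]_k) : X \in unitmx -> absz (\det X) = 1%N.
  by rewrite unitmxE => /orP[] /eqP->.
have -> : absz (\det M) = (\prod_i absz (D 0%R i))%N.
  rewrite eM !det_mulmx !abszM (absU U)// (absU W)// mul1n muln1 det_diag.
  by elim/big_rec2: _ => // i m n _ <-; rewrite abszM.
move=> detM.
have D0 i : (0 < absz (D 0%R i))%N.
  rewrite absz_gt0; apply: contraNneq detM => Di0.
  by rewrite eM !det_mulmx det_diag (bigD1 i)//= Di0 mul0r mulr0 mul0r.
apply: card_eq_trans (card_cube_diag D0).
apply: (card_cube_unimodular Uu) => [a b|a /=].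
  move=> /mxOverP ab bZ i; rewrite -(subrK (b 0 i) (a 0 i)) mulrDl rpredD//.
  by rewrite rpredM ?natr_int//; have := ab 0 i; rewrite !mxE.
set c := a *m _.
have -> : a *m map_mx intr M =
    c *m diag_mx (map_mx intr D) *m map_mx intr W.
  by rewrite eM !map_mxM map_diag_mx !mulmxA.
have WV : map_mx intr W *m map_mx intr (invmx W) = 1%:M :> 'M[R]_k.
  by rewrite -map_mxM mulmxV// map_mx1.
split=> [cZ i|cZ].
  have : c *m diag_mx (map_mx intr D) \is a mxOver Num.int.
    by rewrite -[c *m diag_mx _]mulmx1 -WV mulmxA int_mxM// int_map_intr.
  move=> /mxOverP/(_ 0 i).
  by rewrite mul_mx_diag mxE [X in _ * X]mxE int_mul_abs.
apply: int_mxM (int_map_intr _ _); apply/mxOverP => j i.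
by rewrite mul_mx_diag mxE ord1 [X in _ * X]mxE int_mul_abs; apply: cZ.
Qed.

End LatticePointsOfACube.

(** * Barycentric coordinates *)

Section BarycentricCoordinates.
Variables (R : realType) (k d : nat).
Implicit Types (a : 'rV[R]_k.+1) (c : 'rV[R]_k) (v : 'M[R]_(k.+1, d)).

Definition insert (i : 'I_k.+1) (t : R) c : 'rV[R]_k.+1 :=
  \row_j oapp (c 0) t (unlift i j).

Lemma insert_at i t c : insert i t c 0 i = t.
Proof. by rewrite mxE unlift_none. Qed.

Lemma insert_lift i t c j : insert i t c 0 (lift i j) = c 0 j.
Proof. by rewrite mxE liftK. Qed.

Lemma col'_insert i t c : col' i (insert i t c) = c.
Proof. by apply/rowP => j; rewrite mxE insert_lift. Qed.

Lemma sum_coords i a : \sum_j a 0 j = a 0 i + \sum_j (col' i a) 0 j.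
Proof.
by rewrite (bigD1_ord i)//=; congr (_ + _); apply: eq_bigr => j _; rewrite mxE.
Qed.

Lemma mulmx_coords i a v :
  a *m v = a 0 i *: row i v + col' i a *m row' i v.
Proof.
apply/rowP => l; rewrite !mxE (bigD1_ord i)//=; congr (_ + _).
by apply: eq_bigr => j _; rewrite !mxE.
Qed.

Lemma mulmx_edges a v :
  a *m v = (\sum_j a 0 j) *: row ord0 v + col' ord0 a *m edges v.
Proof.
rewrite (sum_coords ord0) (mulmx_coords ord0) scalerDl -addrA; congr (_ + _).
apply/rowP => l; rewrite !mxE mulr_suml -big_split; apply: eq_bigr => j _.
by rewrite !mxE mulrBr [RHS]addrC subrK.
Qed.

Lemma affinely_independentP v : affinely_independent v <->
  forall a, \sum_i a 0 i = 0 -> a *m v = 0 -> a = 0.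
Proof.
split=> [ind a a0|ind].
  rewrite mulmx_edges a0 scale0r add0r -(mul0mx _ (edges v)).
  move=> /(row_free_inj ind) c0; apply/rowP => j; rewrite mxE.
  case: (unliftP ord0 j) => [i ->|->].
    by move/rowP/(_ i): c0; rewrite !mxE.
  by move: a0; rewrite (sum_coords ord0) c0 big1 ?addr0// => i _; rewrite mxE.
apply: inj_row_free => c c0.
have sum0 : \sum_j insert ord0 (- \sum_j c 0 j) c 0 j = 0.
  by rewrite (sum_coords ord0) insert_at col'_insert addNr.
suff /(congr1 (col' ord0)) : insert ord0 (- \sum_j c 0 j) c = 0.
  by rewrite col'_insert => ->; apply/rowP => j; rewrite !mxE.
by apply: ind; rewrite // mulmx_edges sum0 scale0r add0r col'_insert.
Qed.

Lemma affine_coords_inj v : affinely_independent v -> forall a b : 'rV[R]_k.+1,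
  \sum_i a 0 i = \sum_i b 0 i -> a *m v = b *m v -> a = b.
Proof.
move=> /affinely_independentP ind a b ab abv.
apply/eqP; rewrite -subr_eq0; apply/eqP.
apply: ind; last by rewrite mulmxBl abv subrr.
under eq_bigr do rewrite !mxE.
by rewrite sumrB ab subrr.
Qed.

End BarycentricCoordinates.

Lemma affinely_independent_facet (R : realType) k d (v : 'M[R]_(k.+2, d)) i :
  affinely_independent v -> affinely_independent (facet v i).
Proof.
move=> /affinely_independentP ind; apply/affinely_independentP => a a0 av.
suff /(congr1 (col' i)) : insert i 0 a = 0.
  by rewrite col'_insert => ->; apply/rowP => j; rewrite !mxE.
apply: ind; first by rewrite (sum_coords i) insert_at col'_insert a0 addr0.
by rewrite (mulmx_coords i) insert_at col'_insert scale0r add0r.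
Qed.

(** * The box of a simplex and the normalized volume *)

Definition box (R : realType) k d (L : set 'rV[R]_d) (v : 'M[R]_(k.+1, d)) :
    set 'rV[R]_k.+1 :=
  @cube R k.+1 `&`
  [set a : 'rV[R]_k.+1 | \sum_i a 0 i \is a Num.int /\ L (a *m v)].

Section Volume.
Variables (R : realType) (m d : nat) (B : 'M[R]_(m, d)).
Local Notation L := (int_span B).

Lemma int_spanD x y : L x -> L y -> L (x + y).
Proof.
move=> /int_spanP[a aZ ->] /int_spanP[b bZ ->]; apply/int_spanP.
by exists (a + b); rewrite ?mulmxDl// int_mxD.
Qed.

Lemma int_spanB x y : L x -> L y -> L (x - y).
Proof.
move=> /int_spanP[a aZ ->] /int_spanP[b bZ ->]; apply/int_spanP.
by exists (a - b); rewrite ?mulmxBl// int_mxB.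
Qed.

Lemma int_span_rows k (v : 'M[R]_(k, d)) : (forall i, L (row i v)) ->
  exists N : 'M[int]_(k, m), v = map_mx intr N *m B.
Proof.
move=> /choice[z zE]; exists (\matrix_i z i); apply/row_matrixP => i.
by rewrite row_mul zE -map_row rowK.
Qed.

Lemma int_span_comb k (v : 'M[R]_(k, d)) (c : 'rV[R]_k) :
  (forall i, L (row i v)) -> c \is a mxOver Num.int -> L (c *m v).
Proof.
move=> /int_span_rows[N ->] cZ; apply/int_spanP.
by exists (c *m map_mx intr N); rewrite ?mulmxA// int_mxM// int_map_intr.
Qed.

Variables (k : nat) (v : 'M[R]_(k.+1, d)).
Hypothesis vL : forall i, L (row i v).

Lemma edges_int_span i : L (row i (edges v)).
Proof. by rewrite rowK; apply: int_spanB. Qed.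

Lemma affine_latticeP y : affine_lattice L v y <->
  L y /\ exists c : 'rV[R]_k, y = c *m edges v.
Proof.
split=> [[x [Lx [a a1 ax]] <-]|[Ly [c yc]]].
  split; first exact: int_spanB.
  by exists (col' ord0 a); rewrite ax mulmx_edges a1 scale1r addrC addKr.
exists (y + row ord0 v); last by rewrite addrK.
split; first exact: int_spanD.
pose a := insert ord0 (1 - \sum_j c 0 j) c.
have a1 : \sum_j a 0 j = 1.
  by rewrite (sum_coords ord0) insert_at col'_insert subrK.
by exists a; rewrite // mulmx_edges a1 scale1r col'_insert yc addrC.
Qed.

Hypotheses (Bfree : row_free B) (vind : affinely_independent v).

(** Write the edges as [U D P W B] with [U] and [W] unimodular, [D] diagonal of
    size [k], and [P] the projection to the first [k] coordinates: the first [k]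
    vectors of the basis [W B] of [L] span the real row space of the edges, and
    an integer combination of [W B] in that space only involves these. *)
Lemma affine_lattice_basis : exists (b : 'M[R]_(k, d)) (M : 'M[R]_k),
  lattice_basis (affine_lattice L v) b /\ edges v = M *m b.
Proof.
have [N eN] := int_span_rows edges_int_span.
have [U _ [W Wu [s _ eS]]] := int_Smith_normal_form N.
pose D : 'M[int]_k := diag_mx (\row_i s`_i).
pose P : 'M[int]_(k, m) := pid_mx k.
have eD : N = U *m D *m (P *m W).
  rewrite {1}eS mulmxA -[in RHS](mulmxA U); congr (_ *m _ *m _).
  apply/matrixP => i j; rewrite mul_diag_mx !mxE ltn_ord andbT.
  by rewrite mulr_natr.
pose X : 'M[R]_k := map_mx intr (U *m D).
pose b : 'M[R]_(k, d) := map_mx intr (P *m W) *m B.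
have eb : edges v = X *m b by rewrite eN eD map_mxM -mulmxA.
have rk : \rank (X *m b) = k by apply/eqP; rewrite -eb.
have bfree : row_free b by rewrite -row_leq_rank -{1}rk mxrankM_maxr.
have Xu : X \in unitmx.
  by rewrite -row_free_unit -row_leq_rank -{1}rk mxrankM_maxl.
have km : (k <= m)%N.
  by rewrite -rk -eb eN (leq_trans (mxrankM_maxl _ _))// rank_leq_col.
exists b, X; split=> //; split=> //; apply/seteqP; split=> y.
  move=> /affine_latticeP[/int_spanP[w wZ yw] [c yc]]; apply/int_spanP.
  exists (c *m X); last by rewrite yc eb mulmxA.
  have /(row_free_inj Bfree) e : c *m X *m map_mx intr (P *m W) *m B = w *m B.
    by rewrite -yw yc eb !mulmxA.
  (* The first [k] coordinates on [W B] are read off by [W^-1] and [P^T]. *)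
  have PW1 : map_mx intr (P *m W) *m (map_mx intr (invmx W) *m
      map_mx intr (pid_mx k : 'M[int]_(m, k))) = 1%:M :> 'M[R]_k.
    rewrite -!map_mxM -mulmxA (mulmxA W) mulmxV// mul1mx.
    by rewrite mul_pid_mx minnn (minn_idPr km) pid_mx_1 map_mx1.
  rewrite -[c *m X]mulmx1 -PW1 !(mulmxA (c *m X)) e.
  by rewrite !int_mxM ?int_map_intr.
move=> /int_spanP[z zZ yz]; apply/affine_latticeP; split.
  rewrite yz mulmxA; apply/int_spanP.
  by eexists; last by []; rewrite int_mxM// int_map_intr.
by exists (z *m invmx X); rewrite eb mulmxA mulmxKV.
Qed.

(** The coordinate of vertex 0 is recovered from the other ones: it is the point
    of [[0, 1)] congruent to minus their sum. *)
Lemma card_box_cube :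
  (box L v #= @cube R k `&` [set c : 'rV[R]_k | L (c *m edges v)])%card.
Proof.
have ZL (t : R) : t \is a Num.int -> L (t *: row ord0 v).
  move=> tZ; have /int_spanP[w wZ ->] := vL ord0; apply/int_spanP.
  exists (t *: w); last by rewrite scalemxAl.
  by move/mxOverP: wZ => wZ; apply/mxOverP => i j; rewrite mxE rpredM.
have -> : @cube R k `&` [set c : 'rV[R]_k | L (c *m edges v)] =
    col' ord0 @` box L v.
  apply/seteqP; split=> [c [cc Lc]|_ [a [ca [aZ La]] <-]].
    exists (insert ord0 (fract (- \sum_j c 0 j)) c); last exact: col'_insert.
    have sZ : \sum_j insert ord0 (fract (- \sum_j c 0 j)) c 0 j \is a Num.int.
      rewrite (sum_coords ord0) insert_at col'_insert /fract addrAC addNr add0r.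
      by rewrite rpredN intr_int.
    split; last first.
      split=> //; rewrite mulmx_edges col'_insert.
      by apply: int_spanD => //; apply: ZL.
    move=> j; case: (unliftP ord0 j) => [i ->|->]; first by rewrite insert_lift.
    by rewrite insert_at fract_itv.
  split=> [i|/=]; first by rewrite mxE.
  have -> : col' ord0 a *m edges v = a *m v - (\sum_j a 0 j) *: row ord0 v.
    by rewrite [in RHS]mulmx_edges addrAC subrr add0r.
  by apply: int_spanB => //; apply: ZL.
rewrite card_eq_sym; apply: inj_card_eq => a b; rewrite !inE.
move=> [ca [aZ _]] [cb [bZ _]] ab; apply: eq_cube_of_int_sub => //.
have ab0 : a 0 ord0 - b 0 ord0 \is a Num.int.
  have := rpredB aZ bZ; rewrite !(sum_coords ord0) ab.
  by rewrite opprD addrACA subrr addr0.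
apply/mxOverP => i j; rewrite !mxE ord1; case: (unliftP ord0 j) => [l ->|->] //.
by move/rowP/(_ l): ab; rewrite !mxE => ->; rewrite subrr.
Qed.

(** The default value of the volume is excluded by [affine_lattice_basis].  For any
    basis [b] of the affine lattice, the box counts the points of the cube that
    the matrix of the edges in [b] maps to integer rows. *)
Lemma card_box :
  exists2 n, (box L v #= `I_n)%card & normalized_volume L v = n%:R.
Proof.
have [b0 [M0 [b0basis eM0]]] := affine_lattice_basis.
rewrite /normalized_volume.
case: xgetP => [_ _ [b [M [[bfree bL] eM ->]]]|noP]; last first.
  by case: (noP `|\det M0|); exists b0, M0.
have LZ c : L (c *m edges v) <-> c *m M \is a mxOver Num.int.
  transitivity (int_span b (c *m M *m b)).
    rewrite -bL -mulmxA -eM; split=> [Lc|/affine_latticeP[]//].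
    by apply/affine_latticeP; split=> //; exists c.
  split=> [/int_spanP[z zZ /(row_free_inj bfree)->]//|cMZ].
  by apply/int_spanP; exists (c *m M).
have [N eN] : exists N : 'M[int]_k, M = map_mx intr N.
  apply: int_mxP; apply/mxOverP => i j.
  have /mxOverP/(_ 0 j) : row i M \is a mxOver Num.int.
    by rewrite rowE; apply/LZ; rewrite -rowE; apply: edges_int_span.
  by rewrite mxE.
have detN : \det N != 0.
  have : M \in unitmx.
    have rk : \rank (M *m b) = k by apply/eqP; rewrite -eM.
    by rewrite -row_free_unit -row_leq_rank -{1}rk mxrankM_maxl.
  by rewrite eN unitmxE det_map_mx unitfE intr_eq0.
exists (absz (\det N)).
  apply: card_eq_trans card_box_cube _.
  have -> : [set c : 'rV[R]_k | L (c *m edges v)] =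
      [set c : 'rV[R]_k | c *m map_mx intr N \is a mxOver Num.int].
    by apply/seteqP; split=> c; rewrite -eN => /LZ.
  exact: card_cube_int_preimage.
by rewrite eN det_map_mx -intr_norm -abszE.
Qed.

End Volume.

(** * The series of [1 / (1 - x)^(k+1)] *)

Section BinomialSeries.
Variable R : nzRingType.

Let F k n : {poly R} := \poly_(j < n.+1) ('C(k + j, k)%:R).

Let F_recr k n : F k n.+1 = F k n + 'C(k + n.+1, k)%:R%:P * 'X^(n.+1).
Proof. by rewrite /F !poly_def big_ord_recr /= mul_polyC. Qed.

Let F0_mul n : F 0 n * (1 - 'X) = 1 - 'X^(n.+1).
Proof.
elim: n => [|n IHn].
  by rewrite /F poly_def big_ord1 bin0 scale1r expr0 mul1r.
rewrite F_recr mulrDl IHn bin0 polyC1 mul1r mulrBr mulr1 -exprSr.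
by rewrite addrA subrK.
Qed.

Let FS_mul k n :
  F k.+1 n * (1 - 'X) = F k n - 'C(k.+1 + n, k.+1)%:R%:P * 'X^(n.+1).
Proof.
elim: n => [|n IHn].
  rewrite /F !poly_def !big_ord1 !addn0 !binn expr0 scale1r polyC1.
  by rewrite !mul1r.
rewrite !F_recr mulrDl IHn mulrBr mulr1 -mulrA -exprSr.
have -> : 'C(k.+1 + n.+1, k.+1)%:R%:P * 'X^(n.+1) =
    'C(k + n.+1, k)%:R%:P * 'X^(n.+1)
    + 'C(k.+1 + n, k.+1)%:R%:P * 'X^(n.+1) :> {poly R}.
  by rewrite -mulrDl -polyCD -natrD addSn binS addnC addSnnS.
by rewrite 2!addrA; congr (_ - _); rewrite addrAC subrK.
Qed.

(** Coefficient [m] of [(1 - x)^-(k+1) (1 - x)^(k+1) = 1].  The truncations [F]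
    stand for the power series [(1 - x)^-(k+1)]: multiplication by [1 - x] takes
    [F k.+1 n] to [F k n] up to a term of degree [n + 1]. *)
Lemma binomial_series_inverse k m :
  \sum_(j < m.+1) 'C(k + j, k)%:R * ((1 - 'X : {poly R}) ^+ k.+1)`_(m - j)
    = (m == 0%N)%:R.
Proof.
have -> : \sum_(j < m.+1)
    'C(k + j, k)%:R * ((1 - 'X : {poly R}) ^+ k.+1)`_(m - j)
    = (F k m * (1 - 'X) ^+ k.+1)`_m.
  by rewrite coefM; apply: eq_bigr => j _; rewrite coef_poly ltn_ord.
elim: k => [|k IHk].
  by rewrite expr1 F0_mul coefB coef1 coefXn [m == m.+1]ltn_eqF// subr0.
rewrite exprS mulrA FS_mul mulrBl coefB IHk -mulrA coefCM coefXnM ltnSn.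
by rewrite mulr0 subr0.
Qed.

End BinomialSeries.

(** * Ehrhart series and heights of box points *)

Section NaturalRows.
Variables (R : realType) (k : nat).

Definition nat_rows m : set 'rV[R]_k.+1 :=
  [set c : 'rV[R]_k.+1 |
    (forall i, c 0 i \is a Num.nat) /\ \sum_i c 0 i = m%:R].

Lemma card_nat_rows m : (nat_rows m #= `I_('C(k + m, k)))%card.
Proof.
rewrite -card_ord_partitions; set A := [set t | _]%SET.
rewrite -(card_sig (mem A)); apply: card_eq_trans (card_finType _).
pose g (t : {t | t \in A}) : 'rV[R]_k.+1 := \row_i (tnth (val t) i)%:R.
have -> : nat_rows m = g @` setT.
  apply/seteqP; split=> [c [cN cm]|_ [[t tA] _ <-]]; last first.
    split=> [i|]; first by rewrite mxE natr_nat.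
    have /eqP tm : (\sum_(i <- t) i == m)%N by move: (tA); rewrite inE.
    rewrite -[in RHS]tm big_tuple natr_sum.
    by apply: eq_bigr => i _; rewrite mxE.
  have cK i : (Num.truncn (c 0 i))%:R = c 0 i by apply: truncnK.
  have cm' : (\sum_i Num.truncn (c 0%R i))%N = m.
    by apply/eqP; rewrite -(eqr_nat R) natr_sum -cm; apply/eqP/eq_bigr => i _.
  have clt i : (Num.truncn (c 0%R i) < m.+1)%N.
    by rewrite ltnS -cm' (bigD1 i)//= leq_addr.
  pose t := [tuple Ordinal (clt i) | i < k.+1].
  have tA : t \in A.
    rewrite inE big_tuple; apply/eqP; rewrite -[RHS]cm'.
    by apply: eq_bigr => i _; rewrite tnth_mktuple.
  exists (exist _ t tA) => //; apply/rowP => i.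
  by rewrite mxE tnth_mktuple /=; apply: cK.
apply: inj_card_eq => s t _ _ /rowP st; apply/val_inj/eq_from_tnth => i.
apply/val_inj/eqP; rewrite -(eqr_nat R); apply/eqP.
by have := st i; rewrite !mxE.
Qed.

End NaturalRows.

Lemma card_seq (T : choiceType) (s : seq T) :
  uniq s -> ([set` s] #= `I_(size s))%card.
Proof.
move=> us; have -> : [set` s] = [set` [fset x in s]%fset].
  by apply/seteqP; split=> x /=; rewrite inE.
by apply/card_eq_fsetP; rewrite card_fseq undup_id.
Qed.

Section Ehrhart.
Variables (R : realType) (m d k : nat) (B : 'M[R]_(m, d)) (v : 'M[R]_(k.+1, d)).
Local Notation L := (int_span B).
Hypotheses (Bfree : row_free B) (vind : affinely_independent v).
Hypothesis vL : forall i, L (row i v).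

Definition box_points := fset_set (box L v).

Lemma finite_box : finite_set (box L v).
Proof. by have [n nb _] := card_box vL Bfree vind; apply/finite_setP; exists n. Qed.

Lemma box_pointsP a : reflect (box L v a) (a \in box_points).
Proof. by rewrite in_fset_set ?inE; [exact: asboolP | exact: finite_box]. Qed.

Definition height (a : 'rV[R]_k.+1) : nat := Num.truncn (\sum_i a 0 i).

Lemma heightE a : box L v a -> (height a)%:R = \sum_i a 0 i.
Proof.
move=> [ca [aZ _]]; apply: truncnK; rewrite natrEint aZ sumr_ge0// => i _.
by case/andP: (ca i).
Qed.

Lemma height_lt a : box L v a -> (height a < k.+1)%N.
Proof.
move=> ba; rewrite -(ltr_nat R) (heightE ba).
have -> : k.+1%:R = \sum_(i < k.+1) 1 :> R by rewrite sumr_const card_ord.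
have [ca _] := ba.
apply: ltr_sum => [|i _]; last by case/andP: (ca i).
by apply/hasP; exists ord0; rewrite ?mem_index_enum.
Qed.

Lemma height_eq0 a : box L v a -> (height a == 0)%N = (a == 0).
Proof.
move=> ba; rewrite -(eqr_nat R) (heightE ba).
have [ca _] := ba; rewrite psumr_eq0; last by move=> i _; case/andP: (ca i).
apply/allP/eqP => [a0|-> i _]; last by rewrite mxE eqxx.
by apply/rowP => i; rewrite mxE; apply/eqP/a0; rewrite mem_index_enum.
Qed.

Lemma box_fract_row (c : 'rV[R]_k.+1) :
  \sum_i c 0 i \is a Num.int -> L (c *m v) -> box L v (fract_row c).
Proof.
move=> cZ Lc; have frZ := int_sub_fract_row c.
split; first exact: cube_fract_row.
split.
  have -> : \sum_i fract_row c 0 i =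
      \sum_i c 0 i - \sum_i (c - fract_row c) 0 i.
    by rewrite -sumrB; apply: eq_bigr => i _; rewrite !mxE opprB addrC subrK.
  by rewrite rpredB// rpred_sum// => i _; move/mxOverP: frZ.
have -> : fract_row c *m v = c *m v - (c - fract_row c) *m v.
  by rewrite mulmxBl opprB addrC subrK.
by apply: int_spanB => //; apply: int_span_comb.
Qed.

Definition cone_slice n : set 'rV[R]_k.+1 :=
  [set c : 'rV[R]_k.+1 |
    [/\ forall i, 0 <= c 0 i, \sum_i c 0 i = n%:R & L (c *m v)]].

(** Barycentric coordinates identify the lattice points of [nP] with the slice;
    [n = 0] is treated apart, since then the point does not determine the weights
    of the vertices. *)
Lemma card_dilate n :
  (dilate n%:R (conv_hull v) `&` L #= cone_slice n)%card.
Proof.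
have -> : dilate n%:R (conv_hull v) `&` L = (mulmx^~ v) @` cone_slice n.
  apply/seteqP; split=> [_ [[_ [a [a0 a1] ->] <-] La]|_ [c [c0 cn Lc] <-]].
    exists (n%:R *: a); last by rewrite -scalemxAl.
    split=> [i||]; first by rewrite mxE mulr_ge0.
      by under eq_bigr do rewrite mxE; rewrite -mulr_sumr a1 mulr1.
    by rewrite -scalemxAl.
  split=> //; have [n0|n0] := eqVneq n 0%N.
    have c00 : c = 0.
      apply/rowP => i; rewrite mxE; move: cn; rewrite n0 => /eqP.
      by rewrite psumr_eq0// => /allP/(_ i (mem_index_enum _))/eqP.
    exists (row ord0 v); last by rewrite c00 n0 mul0mx scale0r.
    exists (delta_mx 0 ord0); last exact: rowE.
    split=> [i|]; first by rewrite mxE ler0n.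
    rewrite (bigD1 ord0)//= big1 => [|i /negPf i0]; rewrite mxE ?i0//.
    by rewrite !eqxx addr0.
  have nR0 : n%:R != 0 :> R by rewrite pnatr_eq0.
  exists ((n%:R^-1 *: c) *m v);
    last by rewrite -scalemxAl scalerA divff// scale1r.
  exists (n%:R^-1 *: c) => //; split=> [i|].
    by rewrite mxE mulr_ge0// invr_ge0.
  by under eq_bigr do rewrite mxE; rewrite -mulr_sumr cn mulVf.
apply: inj_card_eq => a b; rewrite !inE => -[_ an _] [_ bn _].
by apply: affine_coords_inj => //; rewrite an bn.
Qed.

(** A row [c] of the slice is [frac(c) + floor(c)], where [frac(c)] is in the
    box and [floor(c)] is a row of natural numbers with sum [n - height (frac(c))]. *)
Lemma card_cone_slice n : (cone_slice n #=
  `I_(\sum_(a <- box_points | (height a <= n)%N) 'C(k + (n - height a), k)))%card.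
Proof.
pose N l := fset_set (@nat_rows R k l).
have inN l c : (c \in N l) = `[< nat_rows l c >].
  rewrite in_fset_set ?inE//; apply/finite_setP; exists 'C(k + l, k).
  exact: card_nat_rows.
pose s := [seq a + c | a <- [seq a <- box_points | (height a <= n)%N],
                       c <- N (n - height a)%N].
have us : uniq s.
  apply: allpairs_uniq_dep => [|a _|]; [|exact: fset_uniq|].
    exact: filter_uniq (fset_uniq _).
  move=> _ _ /allpairsPdep[a [c [aS cN ->]]] /allpairsPdep[b [e [bS eN ->]]] /=.
  move: aS bS cN eN; rewrite !mem_filter.
  move=> /andP[_ /box_pointsP[ca _]] /andP[_ /box_pointsP[cb _]].
  rewrite !inN => /asboolP[cN _] /asboolP[eN _] ab.
  have eab : a = b.
    apply: eq_cube_of_int_sub => //; apply/mxOverP => i j.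
    have -> : a - b = e - c.
      by apply/eqP; rewrite subr_eq addrAC eq_sym subr_eq addrC ab addrC.
    by rewrite !mxE !ord1 rpredB// intr_nat.
  by move: ab; rewrite eab => /addrI ->.
have -> : cone_slice n = [set` s].
  apply/seteqP; split=> [c [c0 cn Lc]|_ /= /allpairsPdep[a [c [aS cN ->]]]].
    have frZ : c - fract_row c \is a mxOver Num.int by apply: int_sub_fract_row.
    have bfr : box L v (fract_row c).
      by apply: box_fract_row => //; rewrite cn natr_int.
    have hfr := heightE bfr.
    have hle : (height (fract_row c) <= n)%N.
      rewrite -(ler_nat R) hfr -cn; apply: ler_sum => i _.
      by rewrite mxE gerBl ler0z floor_ge0.
    apply/allpairsPdep; exists (fract_row c), (c - fract_row c).
    rewrite mem_filter hle inN; split=> //; last by rewrite addrC subrK.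
      by apply/box_pointsP.
    apply/asboolP; split=> [i|].
      rewrite natrEint; move/mxOverP: frZ => -> /=.
      by rewrite !mxE opprB addrC subrK ler0z floor_ge0.
    by rewrite natrB// hfr -cn -sumrB; apply: eq_bigr => i _; rewrite !mxE.
  move: aS cN; rewrite mem_filter inN.
  move=> /andP[han /box_pointsP ba] /asboolP[cN cs].
  have [ca [aZ La]] := ba; split=> [i||].
  - by rewrite mxE addr_ge0//; [case/andP: (ca i) | apply: natr_ge0].
  - under eq_bigr do rewrite mxE.
    by rewrite big_split /= -(heightE ba) cs -natrD subnKC.
  - rewrite mulmxDl; apply: int_spanD => //; apply: int_span_comb => //.
    by apply/mxOverP => i j; rewrite ord1 intr_nat.
have <- : size s =
    \sum_(a <- box_points | (height a <= n)%N) 'C(k + (n - height a), k).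
  rewrite size_allpairs_dep sumnE big_map big_filter; apply: eq_bigr => a _.
  exact/card_fset_set/card_nat_rows.
exact: card_seq.
Qed.

Lemma ehrhartE n : ehrhart L (conv_hull v) n =
  \sum_(a <- box_points | (height a <= n)%N) 'C(k + (n - height a), k).
Proof.
by apply: card_fset_set; apply: card_eq_trans (card_dilate n) (card_cone_slice n).
Qed.

(** By [ehrhartE] a box point of height [h] contributes [x^h / (1 - x)^(k+1)] to
    the Ehrhart series. *)
Lemma ehrhart_series n :
  \sum_(i < n.+1) (ehrhart L (conv_hull v) i)%:R
     * ((1 - 'X : {poly R}) ^+ k.+1)`_(n - i)
  = (count (fun a => height a == n) box_points)%:R.
Proof.
set p := _ ^+ _.
under eq_bigr do rewrite ehrhartE natr_sum mulr_suml big_mkcond.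
rewrite exchange_big /= -sum1_count natr_sum [RHS]big_mkcond /=.
apply: eq_bigr => a _; rewrite -big_mkcond/=; set h := height a.
have [hn|nh] := leqP h n; last first.
  rewrite big_pred0 ?gtn_eqF// => i; apply/negbTE; rewrite -ltnNge.
  by rewrite (leq_trans (ltn_ord i)).
have -> : (if h == n then 1%:R else 0 : R) = (n - h == 0)%N%:R.
  by rewrite subn_eq0 eqn_leq hn; case: leqP.
rewrite -(binomial_series_inverse R k (n - h)).
rewrite -(big_geq_mkord h n.+1 xpredT
  (fun i => 'C(k + (i - h), k)%:R * p`_(n - i))).
rewrite -{1}[h]add0n big_addn big_mkord subSn//; apply: eq_bigr => j _.
by rewrite addnK subnDA subnAC.
Qed.

(** * The involution of the box *)

Lemma size_box_points : normalized_volume L v = (size box_points)%:R.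
Proof. by have [n /card_fset_set <- ->] := card_box vL Bfree vind. Qed.

Lemma fract_opp (x : R) : 0 <= x < 1 -> x + fract (- x) = 1 - (x == 0)%:R.
Proof.
move=> /andP[x0 x1]; have [->|xn0] := eqVneq x 0.
  by rewrite /fract oppr0 floor0 subrr add0r subrr.
suff -> : fract (- x) = 1 - x by rewrite subr0 addrC subrK.
have xgt0 : 0 < x by rewrite lt_def xn0.
apply: eq_of_int_sub (fract_itv _) _ _; first by apply/andP; split; lra.
have -> : fract (- x) - (1 - x) = - (Num.floor (- x))%:~R - 1.
  by rewrite /fract; lra.
by rewrite rpredB ?rpredN ?rpred1 ?intr_int.
Qed.

(** The involution [a |-> frac(- a)] of the box pairs the coordinate [a_i] with
    [1 - a_i], except that it fixes [a_i = 0]. *)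
Lemma sum_coord_box_points i :
  2 * \sum_(a <- box_points) a 0 i =
    (size box_points)%:R
      - (count (fun a : 'rV[R]_k.+1 => a 0 i == 0) box_points)%:R :> R.
Proof.
pose opp (a : 'rV[R]_k.+1) := fract_row (- a).
have opp_box a : a \in box_points -> opp a \in box_points.
  move=> /box_pointsP[_ [aZ La]]; apply/box_pointsP; apply: box_fract_row.
    by under eq_bigr do rewrite mxE; rewrite sumrN rpredN.
  rewrite mulNmx -[- _]add0r; apply: int_spanB => //.
  apply/int_spanP; exists 0; rewrite ?mul0mx//.
  by apply/mxOverP => r j; rewrite mxE.
have oppK : {in box_points, cancel opp opp}.
  move=> a /box_pointsP[ca _].
  apply: eq_cube_of_int_sub => //; first exact: cube_fract_row.
  have -> : opp (opp a) - a = (- a - opp a) - (- opp a - opp (opp a)).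
    by rewrite opprB opprK [RHS]addrC -addrA (addrCA (opp a)) subrr addr0.
  by apply: int_mxB; apply: int_sub_fract_row.
have perm_opp : perm_eq [seq opp a | a <- box_points] box_points.
  apply: uniq_perm => [||a].
    by rewrite (map_inj_in_uniq (can_in_inj oppK)) fset_uniq.
    exact: fset_uniq.
  apply/mapP/idP => [[b bS ->]|aS]; first exact: opp_box.
  by exists (opp a); [exact: opp_box | rewrite oppK].
have -> : 2 * \sum_(a <- box_points) a 0 i =
    \sum_(a <- box_points) (a 0 i + fract (- a 0 i)).
  rewrite mulr_natl mulr2n big_split /=; congr (_ + _).
  rewrite -(perm_big _ perm_opp) big_map.
  by apply: eq_bigr => a _; rewrite !mxE.
rewrite -[size _]sum1_size -sum1_count !natr_sum [X in _ - X]big_mkcond.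
rewrite -sumrB /=.
apply: eq_big_seq => a /box_pointsP[ca _].
by rewrite (fract_opp (ca i)); case: eqP.
Qed.

End Ehrhart.

(** * Facets and the sum of the heights *)

Section SurfaceArea.
Variables (R : realType) (m d k : nat) (B : 'M[R]_(m, d)) (v : 'M[R]_(k.+2, d)).
Local Notation L := (int_span B).
Hypotheses (Bfree : row_free B) (vind : affinely_independent v).
Hypothesis vL : forall i, L (row i v).

(** Deleting the zero coordinate identifies the points of the box with [a_i = 0]
    with the box of the facet. *)
Lemma facet_volume i : normalized_volume L (facet v i) =
  (count (fun a : 'rV[R]_k.+2 => a 0 i == 0) (box_points B v))%:R.
Proof.
have fL j : L (row j (facet v i)).
  have -> // : row j (facet v i) = row (lift i j) v.
  by apply/rowP => l; rewrite !mxE.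
have [n bn ->] := card_box fL Bfree (affinely_independent_facet i vind).
set s := [seq a : 'rV[R]_k.+2 <- box_points B v | a 0 i == 0].
have us : uniq s by apply: filter_uniq; apply: fset_uniq.
have sP a : a \in s <-> box L v a /\ a 0 i = 0.
  rewrite mem_filter.
  split=> [/andP[/eqP ? /(box_pointsP Bfree vind vL)]//|[ba ->]].
  by rewrite eqxx; apply/(box_pointsP Bfree vind vL).
suff e : box L (facet v i) = col' i @` [set` s].
  congr (_%:R); rewrite -size_filter; apply/(@card_eq_II n (size s)).
  apply: card_eq_trans (card_seq us).
  rewrite card_eq_sym in bn; apply: card_eq_trans bn _; rewrite e.
  apply: inj_card_eq => a b; rewrite !inE /= => /sP[_ a0] /sP[_ b0] /rowP ab.
  apply/rowP => j; case: (unliftP i j) => [l ->|->]; last by rewrite a0.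
  by have := ab l; rewrite !mxE.
apply/seteqP; split=> [c [cc [cZ Lc]]|_ [a /= /sP[[ca [aZ La]] a0] <-]].
  exists (insert i 0 c); last exact: col'_insert.
  apply/sP; rewrite insert_at; split=> //; split.
    move=> j; case: (unliftP i j) => [l ->|->]; first by rewrite insert_lift.
    by rewrite insert_at lexx ltr01.
  rewrite /= (sum_coords i) (mulmx_coords i).
  by rewrite insert_at col'_insert scale0r !add0r.
split=> [l|]; first by rewrite mxE.
by move: aZ La; rewrite (sum_coords i) (mulmx_coords i) a0 scale0r !add0r.
Qed.

(** In terms of the h*-vector, [2 sum_j j h*_j = (k + 2) V - S] for a simplex with
    [k + 2] vertices: sum [sum_coord_box_points] over the coordinates, where the
    zeros of the coordinate [i] are counted by the facet opposite to [i]. *)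
Lemma sum_heights :
  2 * \sum_(a <- box_points B v) (height a)%:R =
    k.+2%:R * normalized_volume L v
      - \sum_i normalized_volume L (facet v i).
Proof.
rewrite (size_box_points Bfree vind vL).
under [X in _ - X]eq_bigr do rewrite facet_volume.
have -> : \sum_(a <- box_points B v) (height a)%:R =
    \sum_(a <- box_points B v) \sum_i a 0 i :> R.
  by apply: eq_big_seq => a /(box_pointsP Bfree vind vL)/heightE.
rewrite exchange_big mulr_sumr /=.
rewrite (eq_bigr _ (fun i _ => sum_coord_box_points Bfree vind vL i)).
by rewrite sumrB sumr_const card_ord mulr_natl.
Qed.

End SurfaceArea.

Lemma sum_count (R : nzRingType) (T : eqType) (s : seq T) (h : T -> nat) N
    (f : nat -> R) :
  {in s, forall a, (h a < N)%N} ->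
  \sum_(a <- s) f (h a) = \sum_(j < N) f j * (count (fun a => h a == j) s)%:R.
Proof.
elim: s => [|a s IHs] hs.
  by rewrite big_nil big1// => j _; rewrite mulr0.
rewrite big_cons IHs => [|b bs]; last by rewrite hs// inE bs orbT.
under [RHS]eq_bigr do rewrite /= natrD mulrDr.
rewrite big_split /=; congr (_ + _).
have ha : (h a < N)%N by rewrite hs// mem_head.
rewrite (bigD1 (Ordinal ha))//= eqxx mulr1 big1 ?addr0// => j.
by rewrite -val_eqE/= eq_sym => /negPf ->; rewrite mulr0.
Qed.

(** * Heights in the box of an empty simplex *)

Section EmptySimplex.
Variables (R : realType) (m d k : nat) (B : 'M[R]_(m, d)) (v : 'M[R]_(k.+1, d)).
Local Notation L := (int_span B).
Hypotheses (Bfree : row_free B) (vempty : empty_simplex L v).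

Let vind : affinely_independent v. Proof. by case: vempty. Qed.
Let vL i : L (row i v). Proof. by case: vempty. Qed.

Lemma empty_simplex_coords (a : 'rV[R]_k.+1) :
  (forall i, 0 <= a 0 i) -> \sum_i a 0 i = 1 -> L (a *m v) ->
  exists i, a = delta_mx 0 i.
Proof.
case: vempty => _ _ emp a0 a1 La; have [|i ai] := emp _ _ La; first by exists a.
exists i; apply: (affine_coords_inj vind); last by rewrite -rowE.
rewrite a1 (bigD1 i)//= big1 => [|j /negPf ji]; rewrite mxE ?ji//.
by rewrite !eqxx addr0.
Qed.

(** A point of height 1 is a lattice point of the simplex, hence a vertex, but the
    coordinate 1 is not in [[0, 1)]. *)
Lemma height_neq1 a : box L v a -> height a != 1%N.
Proof.
move=> ba; apply/eqP => h1; have [ca [_ La]] := ba.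
have [i||//|i ai] := empty_simplex_coords (a := a); first by case/andP: (ca i).
  by rewrite -(heightE ba) h1.
by have /andP[_] := ca i; rewrite ai mxE !eqxx ltxx.
Qed.

(** [1 - a] has sum 1, so it is a vertex; but all its coordinates are positive, and
    there are at least two of them. *)
Lemma height_neq_dim a : (0 < k)%N -> box L v a -> height a != k.
Proof.
move=> k0 ba; apply/eqP => hk; have [ca [_ La]] := ba.
pose b : 'rV[R]_k.+1 := const_mx 1 - a.
have [i||| i bi] := empty_simplex_coords (a := b).
- by rewrite !mxE subr_ge0 ltW//; case/andP: (ca i).
- under eq_bigr do rewrite !mxE.
  rewrite sumrB -(heightE ba) hk sumr_const card_ord.
  by rewrite -[k.+1]add1n natrD addrK.
- rewrite mulmxBl; apply: int_spanB => //; apply: int_span_comb => //.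
  by apply/mxOverP => r j; rewrite mxE.
have j : {j : 'I_k.+1 | j != i}.
  by exists (lift i (Ordinal k0)); rewrite eq_sym neq_lift.
have /andP[_] := ca (val j); move/rowP/(_ (val j)): bi; rewrite !mxE.
rewrite (negPf (valP j)) andbF => /eqP; rewrite subr_eq0 => /eqP <-.
by rewrite ltxx.
Qed.

Lemma count_height0 : count (fun a => height a == 0%N) (box_points B v) = 1%N.
Proof.
have S0 : 0 \in box_points B v.
  apply/(box_pointsP Bfree vind vL); split=> [i|/=].
    by rewrite mxE lexx ltr01.
  split; first by rewrite big1// => i _; rewrite mxE.
  by rewrite mul0mx -(subrr (row ord0 v)); apply: int_spanB.
rewrite -[RHS]/(nat_of_bool true) -S0.
rewrite -(count_uniq_mem 0 (fset_uniq (box_points B v))).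
apply: eq_in_count => a /(box_pointsP Bfree vind vL) ba /=.
by rewrite (height_eq0 ba) eq_sym.
Qed.

End EmptySimplex.

(** * Empty 4-simplices *)

Theorem proposition6p1 (R : realType) (L : set 'rV[R]_4) (v : 'M[R]_(5, 4))
    (V : R) (Vf : 'I_5 -> R) (S : R)
    (hL : full_lattice L)
    (hP : empty_simplex L v)
    (hV : V = normalized_volume L v)
    (hVf : forall i, Vf i = normalized_volume L (facet v i))
    (hS : S = \sum_i Vf i)
    (h : 'rV[R]_5) :
  is_hstar_vector L (conv_hull v) h <->
  h = \row_(i < 5) [:: 1; 0; (V + S) / 2 - 3; (V - S) / 2 + 2; 0]`_i.
Proof.
have [B [Bfree LB]] := hL; rewrite {}LB in hP hV hVf *.
have [vind vL _] := hP.
have boxP := box_pointsP Bfree vind vL.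
pose H j := count (fun a => height a == j) (box_points B v).
have count0 j : (forall a, box (int_span B) v a -> height a != j) -> H j = 0%N.
  move=> hj; apply/eqP; rewrite -leqn0 leqNgt -has_count; apply/hasPn => a.
  by move=> /boxP/hj.
have H0 : H 0%N = 1%N := count_height0 Bfree hP.
have H1 : H 1%N = 0%N by apply: count0; exact: height_neq1.
have H4 : H 4%N = 0%N by apply: count0 => a; apply: height_neq_dim.
have Hge5 j : (5 <= j)%N -> H j = 0%N.
  move=> j5; apply: count0 => a /height_lt ha.
  by rewrite ltn_eqF// (leq_trans ha).
have hlt : {in box_points B v, forall a, (height a < 5)%N}.
  by move=> a /boxP/height_lt.
have sumH : V = \sum_(j < 5) (H j)%:R.
  rewrite hV (size_box_points Bfree vind vL) -sum1_size natr_sum.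
  rewrite (sum_count (fun=> 1) hlt).
  by apply: eq_bigr => j _; rewrite mul1r.
have sumjH : 2 * \sum_(j < 5) j%:R * (H j)%:R = 5 * V - S.
  rewrite -(sum_count (fun j => j%:R) hlt) (sum_heights Bfree vind vL) hS -hV.
  by congr (_ - _); apply: eq_bigr => i _; rewrite hVf.
have -> : is_hstar_vector (int_span B) (conv_hull v) h <->
    forall n, (rVpoly h)`_n = (H n)%:R.
  by split=> hh n; have := hh n; rewrite (ehrhart_series Bfree vind vL).
move: sumH sumjH; rewrite !big_ord_recr !big_ord0 /= H0 H1 H4 => sumH sumjH.
have Hrow (i : 'I_5) :
    (H i)%:R = [:: 1; 0; (V + S) / 2 - 3; (V - S) / 2 + 2; 0]`_i.
  by case: i => [[|[|[|[|[|//]]]]] _] /=; rewrite ?H0 ?H1 ?H4//; lra.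
split=> [hh|-> n].
  by apply/rowP => i; rewrite mxE -Hrow -hh coef_rVpoly_ord.
have [n5|n5] := ltnP n 5; last first.
  by rewrite Hge5// nth_default// (leq_trans (size_poly _ _)).
by rewrite (coef_rVpoly_ord _ (Ordinal n5)) mxE -Hrow.
Qed.
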